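(* Let $(M,g)$ be a compact Riemannian manifold without boundary and let $\omega=(\omega^{\nu}_{\lambda\mu})$ be a scalar twisting system that is $*$-compatible, i.e. $\omega^{\nu}_{\mu\lambda}=\overline{\omega^{\nu}_{\lambda\mu}}$ for all $\lambda,\mu,\nu\in\mathrm{Spec}(\Delta)$. Then for all $f,g\in E_{\mathrm{fin}}$ one has, in $L^2(M)$, $$\overline{f\star_\omega g}=\overline g\star_\omega\overline f .$$
   Context: $\Delta$ is the (nonnegative) Laplace–Beltrami operator on complex-valued functions on $M$; its spectrum $\mathrm{Spec}(\Delta)\subset[0,\infty)$ is discrete, each eigenspace $E_\lambda=\ker(\Delta-\lambda)\subset C^\infty(M)$ is finite-dimensional, and $L^2(M)=\bigoplus_\lambda E_\lambda$ orthogonally. $P_\lambda:L^2(M)\to E_\lambda$ is the orthogonal projection. $E_{\mathrm{fin}}:=\bigoplus^{\mathrm{alg}}_{\lambda}E_\lambda$ is the space of finite spectral sums. A scalar twisting system is a family $\omega=(\omega^{\nu}_{\lambda\mu})_{\lambda,\mu,\nu\in\mathrm{Spec}(\Delta)}$ with $\omega^{\nu}_{\lambda\mu}\in\mathbb{T}=\{z\in\mathbb{C}:|z|=1\}$. For $f,g\in E_{\mathrm{fin}}$, the deformed product is the $L^2$-convergent series $f\star_\omega g:=\sum_{\nu}\sum_{\lambda,\mu}\omega^{\nu}_{\lambda\mu}P_\nu\big((P_\lambda f)(P_\mu g)\big)\in L^2(M)$ (for each $\nu$ the inner sum is finite). The bar denotes complex conjugation of functions. *)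

(* Defs.v *)
From HB Require Import structures.
From mathcomp Require Import all_boot all_order all_algebra.
From mathcomp Require Import all_classical all_reals all_analysis.
From mathcomp Require Import complex.

Set Implicit Arguments.
Unset Strict Implicit.
Unset Printing Implicit Defensive.

Import Order.TTheory GRing.Theory Num.Theory.
Import numFieldNormedType.Exports.

Local Open Scope classical_set_scope.
Local Open Scope ring_scope.
Local Open Scope complex_scope.

Section Euclidean.
Context {R : realType}.

Definition partial (n : nat) (i : 'I_n) (F : 'rV[R]_n -> R) : 'rV[R]_n -> R :=
  fun x => 'D_(delta_mx 0 i) F x.

(* Only meaningful for open U. *)
Fixpoint Ck_on (n k : nat) (U : set 'rV[R]_n) (F : 'rV[R]_n -> R) : Prop :=
  match k with
  | 0 => forall x, U x -> {for x, continuous F}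
  | k'.+1 => forall i : 'I_n,
      (forall x, U x -> derivable F x (delta_mx 0 i)) /\
      Ck_on k' U (partial i F)
  end.

Definition smooth_on (n : nat) (U : set 'rV[R]_n) (F : 'rV[R]_n -> R) : Prop :=
  forall k, Ck_on k U F.

(* The Lebesgue integral over R^n of a nonnegative Borel function, as an
   iterated integral (Tonelli). *)
Fixpoint integral_rV (n : nat) : ('rV[R]_n -> \bar R) -> \bar R :=
  match n with
  | 0 => fun F => F 0
  | n'.+1 => fun F =>
      (\int[@lebesgue_measure R]_t
         integral_rV (fun y : 'rV[R]_n' => F (row_mx (t%:M : 'rV[R]_1) y)))%E
  end.

End Euclidean.

Section Manifold.
Context {R : realType} (M : ptopologicalType) (n : nat).

(* The transition maps are quantified over all ordered pairs of charts, so
   they are diffeomorphisms. The atlas is not required to be maximal. *)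
Record smooth_atlas := SmoothAtlas {
  chart : Type ;
  dom : chart -> set M ;
  chart_coord : chart -> M -> 'rV[R]_n ;
  chart_inv : chart -> 'rV[R]_n -> M ;
  chart_at : M -> chart ;
  dom_chart_at : forall p, dom (chart_at p) p ;
  dom_open : forall c, open (dom c) ;
  image_open : forall c, open (chart_coord c @` dom c) ;
  chart_coordK : forall c p, dom c p -> chart_inv c (chart_coord c p) = p ;
  chart_coord_continuous : forall c p, dom c p -> {for p, continuous (chart_coord c)} ;
  chart_inv_continuous : forall c x,
    (chart_coord c @` dom c) x -> {for x, continuous (chart_inv c)} ;
  transition_smooth : forall c d (k : 'I_n),
    smooth_on (chart_coord c @` (dom c `&` dom d))
              (fun x => chart_coord d (chart_inv c x) 0 k) }.

Variable A : smooth_atlas.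

(* Entry (a, k) is the derivative of the k-th coordinate of d with respect to
   the a-th coordinate of c. *)
Definition transition_diff (c d : chart A) (p : M) : 'M[R]_n :=
  \matrix_(a, k) partial a (fun x => chart_coord d (chart_inv c x) 0 k) (chart_coord c p).

(* [gmat c p] is the Gram matrix of the metric at p in the coordinate frame of
   the chart c. *)
Record riemannian_metric := RiemannianMetric {
  gmat : chart A -> M -> 'M[R]_n ;
  gmat_sym : forall c p, dom c p -> (gmat c p)^T = gmat c p ;
  gmat_pos : forall c p (v : 'rV[R]_n), dom c p -> v != 0 ->
    0 < (v *m gmat c p *m v^T) 0 0 ;
  gmat_smooth : forall c (a b : 'I_n),
    smooth_on (chart_coord c @` dom c) (fun x => gmat c (chart_inv c x) a b) ;
  gmat_transition : forall c d p, dom c p -> dom d p ->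
    gmat c p =
      transition_diff c d p *m gmat d p *m (transition_diff c d p)^T }.

Variable g : riemannian_metric.

Definition volume_density (c : chart A) (p : M) : R :=
  Num.sqrt (\det (gmat g c p)).

Definition borel := g_sigma_algebraType (@open M).

Definition is_riemannian_volume (vol : {measure set borel -> \bar R}) : Prop :=
  forall (c : chart A) (B : set borel), measurable B -> B `<=` dom c ->
    vol B = integral_rV (fun x =>
      ((volume_density c (chart_inv c x)) * \1_(chart_coord c @` B) x)%:E).

(* - (det G)^(-1/2) \sum_a d_a (\sum_b (det G)^(1/2) G^(a b) d_b u) *)
Definition chart_laplacian (c : chart A) (u : M -> R) (p : M) : R :=
  - (volume_density c p)^-1 *
    \sum_(a < n) partial a (fun x =>
      \sum_(b < n) volume_density c (chart_inv c x)
        * invmx (gmat g c (chart_inv c x)) a b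
        * partial b (u \o chart_inv c) x) (chart_coord c p).

(* By coordinate invariance the choice of the chart around p is immaterial
   when u is smooth. *)
Definition real_laplacian (u : M -> R) (p : M) : R :=
  chart_laplacian (chart_at A p) u p.

Definition laplacian (f : M -> R[i]) (p : M) : R[i] :=
  real_laplacian (fun q => complex.Re (f q)) p +i*
  real_laplacian (fun q => complex.Im (f q)) p.

Definition smooth (f : M -> R[i]) : Prop :=
  forall c : chart A,
    smooth_on (chart_coord c @` dom c) (fun x => complex.Re (f (chart_inv c x))) /\
    smooth_on (chart_coord c @` dom c) (fun x => complex.Im (f (chart_inv c x))).

Definition Eig (l : R) : set (M -> R[i]) :=
  [set f | smooth f /\ forall p, laplacian f p = l%:C * f p].

Definition Spec : set R :=
  [set l | exists2 f, Eig l f & exists p, f p != 0].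

Definition Efin : set (M -> R[i]) :=
  [set f | exists (s : seq R) (u : R -> M -> R[i]),
     (forall l, l \in s -> Spec l /\ Eig l (u l)) /\
     f = \sum_(l <- s) u l].

Definition conj_fun (f : M -> R[i]) : M -> R[i] := fun p => (f p)^*.

Variable vol : {measure set borel -> \bar R}.

Definition L2_norm_sq (f : M -> R[i]) : \bar R :=
  (\int[vol]_p ((complex.Re (f p)) ^+ 2 + (complex.Im (f p)) ^+ 2)%:E)%E.

Definition L2 : set (M -> R[i]) :=
  [set f | [/\ measurable_fun setT (fun p : borel => complex.Re (f p)),
               measurable_fun setT (fun p : borel => complex.Im (f p)) &
               (L2_norm_sq f < +oo)%E ] ].

Definition L2_inner (f h : M -> R[i]) : R[i] :=
  Rintegral vol setT (fun p => complex.Re (f p * (h p)^*)) +i*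
  Rintegral vol setT (fun p => complex.Im (f p * (h p)^*)).

Definition L2_eq (f h : M -> R[i]) : Prop := {ae vol, forall p, f p = h p}.

(* The orthogonal projection onto the eigenspace; the default value is never
   used for h in L2, since eigenspaces are finite-dimensional. *)
Definition spectral_proj (l : R) (h : M -> R[i]) : M -> R[i] :=
  xget (cst 0) [set u | Eig l u /\
    forall v, Eig l v -> L2_inner (h \- u) v = 0].

(* Unconditional convergence in L2; equivalent to convergence in any order of
   enumeration when, as below, the terms are pairwise orthogonal. *)
Definition L2_sum (J : set R) (F : R -> M -> R[i]) (h : M -> R[i]) : Prop :=
  L2 h /\
  forall e : R, 0 < e -> exists A0 : set R,
    [/\ finite_set A0, A0 `<=` J &
      forall B, finite_set B -> A0 `<=` B -> B `<=` J ->
        (L2_norm_sq (h \- (\sum_(x \in B) F x))%R <= e%:E)%E].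

(* [w l m k] stands for $\omega^k_{l m}$; only its values on the spectrum are
   relevant. *)
Definition twisting_system (w : R -> R -> R -> R[i]) : Prop :=
  forall l m k, Spec l -> Spec m -> Spec k -> `|w l m k| = 1.

Definition star_compatible (w : R -> R -> R -> R[i]) : Prop :=
  forall l m k, Spec l -> Spec m -> Spec k -> w m l k = (w l m k)^*.

Definition star_component (w : R -> R -> R -> R[i]) (f h : M -> R[i]) (k : R) :
    M -> R[i] :=
  \sum_(lm \in Spec `*` Spec)
    (fun p => w lm.1 lm.2 k * spectral_proj k (spectral_proj lm.1 f \* spectral_proj lm.2 h) p).

(* An L2 representative of the sum of the series, which converges for f and h
   in Efin; it is determined up to L2_eq. *)
Definition star (w : R -> R -> R -> R[i]) (f h : M -> R[i]) : M -> R[i] :=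
  xget (cst 0) [set s | L2_sum Spec (star_component w f h) s].

End Manifold.

(* Main.v *)
Require Import Defs.
From HB Require Import structures.
From mathcomp Require Import all_boot all_order all_algebra finmap.
From mathcomp Require Import all_classical all_reals all_analysis.
From mathcomp Require Import complex polyrcf measurable_realfun.
From mathcomp Require Import ring lra.

(* Conjugation maps each eigenspace to itself and reverses the order of the
   factors, and *-compatibility compensates this reversal in the coefficients;
   so everything reduces to the fact that the spectral projections commute with
   conjugation. Since they are defined by a choice, this needs them to be
   unique as functions: two candidates u1, u2 satisfy <u2 - u1, u2 - u1> = 0,
   and u2 - u1 is continuous, hence vanishes because the volume is finite and
   charges every nonempty open set. The convergence of the series is never
   used: its sets of sums for (f, h) and for (conj h, conj f) are conjugate to
   each other, so they are both empty, or both reduced to one class. *)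

Set Implicit Arguments.
Unset Strict Implicit.
Unset Printing Implicit Defensive.

Import Order.TTheory GRing.Theory Num.Theory.
Import numFieldNormedType.Exports.

Local Open Scope classical_set_scope.
Local Open Scope ring_scope.
Local Open Scope complex_scope.

(** * Measure-theoretic and algebraic preliminaries *)

(* Nothing is known about the measurability of the inner integrals of
   [integral_rV], whence this version of [ge0_le_integral]. *)
Lemma ge0_le_integral_nonmeasurable d (T : measurableType d) (R : realType)
    (mu : {measure set T -> \bar R}) (F G : T -> \bar R) :
  (forall x, 0 <= F x)%E -> (forall x, F x <= G x)%E ->
  (\int[mu]_x F x <= \int[mu]_x G x)%E.
Proof.
move=> F0 FG; have G0 x : (0 <= G x)%E := le_trans (F0 x) (FG x).
rewrite !ge0_integralTE//; apply: le_ereal_sup => _ [k kF <-].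
by exists k => // x; apply: le_trans (kF x) (FG x).
Qed.

(** * Iterated Lebesgue integrals compared with integrals over cubes *)

Section integral_rV.
Context {R : realType}.
Local Notation mu := (@lebesgue_measure R).

(** Balls of row vectors are cubes for the sup distance, so they split off their first coordinate.
    This drives the inductions on the dimension, since [integral_rV] integrates that coordinate
    outermost. *)
Lemma ball_row_mx n (x : 'rV[R]_n.+1) (t : R) (y : 'rV[R]_n) (e : R) :
  ball x e (row_mx (t%:M : 'rV[R]_1) y : 'rV[R]_n.+1) <->
  ball (x 0 0) e t /\ ball (rsubmx (x : 'rV_(1 + n)) : 'rV[R]_n) e y.
Proof.
have E0 : (row_mx (t%:M : 'rV[R]_1) y : 'rV[R]_n.+1) 0 0 = t.
  rewrite /row_mx mxE; case: splitP => [j _|j /= //]; by rewrite (ord1 j) mxE eqxx.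
have Er k : (row_mx (t%:M : 'rV[R]_1) y : 'rV[R]_n.+1) 0 (rshift 1 k) = y 0 k.
  exact: (row_mxEr (t%:M : 'rV[R]_1) y 0 k).
split=> [[e0 xy]|[xt [e0 xy]]].
  split; first by have := xy 0 0; rewrite E0.
  by split=> // i j; have := xy 0 (rshift 1 j); rewrite Er mxE (ord1 i).
split=> // i j; rewrite (ord1 i).
have [[k ->]|[k ->]] : (exists k, j = lshift n (k : 'I_1) :> 'I_(1 + n)) \/
   (exists k, j = rshift 1 (k : 'I_n) :> 'I_(1 + n)).
- by case: (split_ordP (j : 'I_(1 + n))) => k ->; [left|right]; exists k.
- rewrite (ord1 k) (_ : lshift n (0 : 'I_1) = (0 : 'I_n.+1)); last exact/val_inj.
  by rewrite E0.
- by have := xy 0 k; rewrite mxE Er.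
Qed.

Lemma integral_rV_ge0 n (F : 'rV[R]_n -> \bar R) :
  (forall x, 0 <= F x)%E -> (0 <= integral_rV F)%E.
Proof.
elim: n F => [|n IH] F F0 /=; first exact: F0.
by apply: integral_ge0 => t _; apply: IH.
Qed.

Lemma integral_cst_ball (x e c : R) : 0 < e -> 0 <= c ->
  (\int[mu]_t (c * \1_(ball x e) t)%:E = (c * (e *+ 2))%:E)%E.
Proof.
move=> e0 c0; rewrite (@integralZl_indic _ _ _ mu _ measurableT (fun=> ball x e) c).
- rewrite integral_indic//; last exact: measurable_ball.
  rewrite setIT EFinM; congr (_ * _)%E; exact: lebesgue_measure_ball (ltW e0).
- by rewrite ltNge c0.
- exact: measurable_ball.
Qed.

(** A cube of side [2e] has volume [(2e)^n]. In the induction, the inner integral is at least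
    [c * (2e)^n] for [t] in the first-coordinate interval and nonnegative elsewhere. This will bound
    volumes of open sets away from zero. *)
Lemma integral_rV_ge_ball n (F : 'rV[R]_n -> \bar R) (x : 'rV[R]_n) (e c : R) :
  0 < e -> 0 <= c -> (forall y, 0 <= F y)%E ->
  (forall y, ball x e y -> c%:E <= F y)%E ->
  ((c * (e *+ 2) ^+ n)%:E <= integral_rV F)%E.
Proof.
move=> e0 c0; elim: n F x => [|n IH] F x F0 cF /=.
  by rewrite expr0 mulr1; apply: cF; split=> // i [].
rewrite exprSr mulrA -(integral_cst_ball (x 0 0))//; last by rewrite mulr_ge0// exprn_ge0// mulrn_wge0// ltW.
apply: ge0_le_integral_nonmeasurable => t.
  by rewrite lee_fin !mulr_ge0// exprn_ge0// mulrn_wge0// ltW.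
have [xt|xt] := pselect (ball (x 0 0) e t).
  rewrite indicE mem_set// mulr1; apply: (IH _ (rsubmx (x : 'rV_(1 + n)))) => // y xy.
  by apply: cF; apply/ball_row_mx.
by rewrite indicE memNset// mulr0; apply: integral_rV_ge0.
Qed.

Lemma integral_rV_le_ball n (F : 'rV[R]_n -> \bar R) (x : 'rV[R]_n) (e c : R) :
  0 < e -> 0 <= c -> (forall y, 0 <= F y)%E ->
  (forall y, F y <= (c * \1_(ball x e) y)%:E)%E ->
  (integral_rV F <= (c * (e *+ 2) ^+ n)%:E)%E.
Proof.
move=> e0; elim: n F x c => [|n IH] F x c c0 F0 Fc /=.
  rewrite expr0 mulr1; apply: le_trans (Fc _) _.
  by rewrite lee_fin ler_piMr// indicE; case: (_ \in _).
rewrite exprSr mulrA -(integral_cst_ball (x 0 0))//; last by rewrite mulr_ge0// exprn_ge0// mulrn_wge0// ltW.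
apply: ge0_le_integral_nonmeasurable => t; first exact: integral_rV_ge0.
(* The induction hypothesis is used with [c] times the indicator of the first-coordinate interval at
   [t] as its constant; this is why [c] is generalized in the induction. *)
rewrite mulrAC; apply: (IH _ (rsubmx (x : 'rV_(1 + n)))) => //.
  by rewrite mulr_ge0// indicE.
move=> y; apply: le_trans (Fc _) _; rewrite lee_fin -mulrA ler_wpM2l//.
rewrite !indicE; case: (pselect (ball x e (row_mx (t%:M : 'rV[R]_1) y : 'rV[R]_n.+1))).
  by move=> /[dup] xy /ball_row_mx[? ?]; rewrite !mem_set// mulr1.
by move=> xy; rewrite memNset// mulr_ge0.
Qed.
End integral_rV.

(* The monic polynomial det(t + B) has no root t >= 0, so it is positive at 0. *)
Lemma posdef_det_gt0 (R : rcfType) n (B : 'M[R]_n) :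
  (forall v : 'rV[R]_n, v != 0 -> 0 < (v *m B *m v^T) 0 0) -> 0 < \det B.
Proof.
move=> B0; pose p := char_poly (- B).
have -> : \det B = p.[0].
  rewrite horner_coef0 char_poly_det -(scaleN1r B) detZ mulrA -exprMn mulrNN.
  by rewrite mulr1 expr1n mul1r.
have [N Np] : exists N, forall x, N <= x -> 1 <= p.[x].
  have /monicP lp := char_poly_monic (- B).
  by have := @poly_pinfty_gt_lc _ p; rewrite lp => /(_ ltr01).
rewrite ltNge; apply/negP => p0.
have b0 : 0 <= Num.max N 0 by rewrite le_max lexx orbT.
have [|t /andP[t0 _]] := poly_ivt b0 (p := p).
  by rewrite p0 (le_trans ler01)// Np// le_max lexx.
(* A root [t >= 0] is an eigenvalue of [- B]; for an eigenvector [v], the form [v B v^T] equals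
   [- t] times a sum of squares, against positivity. *)
rewrite -eigenvalue_root_char => /eigenvalueP[v vB v0].
have := B0 _ v0; rewrite -[B]opprK mulmxN vB mulNmx -scalemxAl !mxE.
apply/negP; rewrite -leNgt oppr_le0 mulr_ge0// sumr_ge0// => i _.
by rewrite !mxE -expr2 sqr_ge0.
Qed.

(** * Continuous functions, open sets and the Borel structure *)

Section borel.
Context {R : realType} (M : ptopologicalType).

Lemma continuous_borel_measurable (u : M -> R) : continuous u ->
  measurable_fun (setT : set (borel M)) u.
Proof.
move=> /continuousP cu; apply: (measurability _ (RGenOpens.measurableE R)) => //.
move=> _ [_ [a [b ->]] <-]; rewrite setTI.
by apply: sub_sigma_algebra; apply: cu; exact: interval_open.
Qed.

Lemma open_borel_measurable (U : set M) : open U -> measurable (U : set (borel M)).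
Proof. by move=> oU; apply: sub_sigma_algebra. Qed.

Lemma continuous_bounded_on_compact (u : M -> R) : compact [set: M] -> continuous u ->
  [bounded u x | x in [set: M]].
Proof.
move=> cM cu; have : compact (u @` setT).
  apply: (continuous_compact _ cM); exact: continuous_subspaceT cu.
move=> /compact_bounded[N [Nr uN]]; exists N; split=> // k Nk x _.
by apply: uN => //; exists x.
Qed.
End borel.

(** * Charts and the Laplacian *)

Section opp.
Context {R : realType}.

(* No convergence is needed: the default value of [lim] on R is 0. *)
Lemma lim_opp (T : Type) (F : set_system T) {FF : ProperFilter F} (f : T -> R) :
  lim (- f x @[x --> F]) = - lim (f x @[x --> F]).
Proof.
have [cf|ncf] := pselect (cvg (f x @[x --> F])); first exact: limN.
rewrite [in RHS]dvgP// dvgP ?oppr0// => cNf; apply: ncf.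
rewrite (_ : f = - (fun x => - f x)); first exact: is_cvgN.
by apply/funext => x; rewrite /GRing.opp /= opprK.
Qed.

Lemma partialN n (i : 'I_n) (F : 'rV[R]_n -> R) :
  partial i (fun x => - F x) = (fun x => - partial i F x).
Proof.
apply/funext => x; rewrite /partial /derive -lim_opp.
apply: (congr1 (fun q : R -> R => lim (q r @[r --> 0^']))).
by apply/funext => r /=; rewrite -scalerN; congr (_ *: _); rewrite opprB opprK addrC.
Qed.

Lemma Ck_onN n k (U : set 'rV[R]_n) (F : 'rV[R]_n -> R) :
  Ck_on k U F -> Ck_on k U (fun x => - F x).
Proof.
elim: k F => [|k IH] F /= cF; first by move=> x Ux; exact: cvgN (cF x Ux).
move=> i; have [dF kF] := cF i; split.
  by move=> x Ux; apply: derivableN; exact: dF.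
by rewrite partialN; exact: IH.
Qed.
End opp.

(** By the Leibniz formula the determinant is a finite sum of products of entries. *)
Lemma det_continuous (R : realType) (T : topologicalType) n (B : T -> 'M[R]_n) x :
  (forall i j, {for x, continuous (fun y => B y i j)}) ->
  {for x, continuous (fun y => \det (B y))}.
Proof.
move=> cB; rewrite /prop_for /continuous_at /determinant.
apply: cvg_big => [|s _]; first exact: add_continuous.
apply: cvgM; first exact: cvg_cst.
apply: cvg_big => [|i _]; first exact: mul_continuous.
exact: cB.
Qed.

Section geometry.
Context {R : realType} {M : ptopologicalType} {n : nat}.
Context {A : @smooth_atlas R M n}.

Lemma chart_near_image (c : chart A) p : dom c p ->
  \forall x \near chart_coord c p, (chart_coord c @` dom c) x.
Proof.
move=> cp; apply: open_nbhs_nbhs; split; first exact: image_open.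
by exists p.
Qed.

(** Near [p], [u] coincides with its coordinate expression composed with [chart_coord], and both are
    continuous. *)
Lemma continuous_from_chart (u : M -> R) :
  (forall c : chart A, Ck_on 0 (chart_coord c @` dom c) (u \o chart_inv c)) ->
  continuous u.
Proof.
move=> su p; pose c := chart_at A p; have cp : dom c p := dom_chart_at A p.
have up : chart_coord c q @[q --> p] --> chart_coord c p.
  exact: chart_coord_continuous.
have := cvg_comp _ _ up (su c _ (imageP _ cp)).
rewrite /= chart_coordK//; apply: cvg_trans; apply: near_eq_cvg.
near=> q; rewrite /= chart_coordK//.
by near: q; apply: open_nbhs_nbhs; split => //; exact: dom_open.
Unshelve. all: by end_near. Qed.

Variable g : riemannian_metric A.

Lemma volume_density_gt0 (c : chart A) p : dom c p -> 0 < volume_density g c p.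
Proof.
by move=> cp; rewrite sqrtr_gt0; apply: posdef_det_gt0 => v; exact: gmat_pos.
Qed.

Lemma volume_density_continuous (c : chart A) p : dom c p ->
  {for chart_coord c p, continuous (volume_density g c \o chart_inv c)}.
Proof.
move=> cp; apply: (@continuous_comp _ _ _ (fun x => \det (gmat g c (chart_inv c x))) Num.sqrt);
  last exact: sqrt_continuous.
(* Level 0 of smoothness is continuity of the metric coefficients. *)
apply: det_continuous => i j; apply: (gmat_smooth g c i j 0%N); exists p => //.
Qed.

Lemma real_laplacianN (u : M -> R) p :
  real_laplacian g (fun q => - u q) p = - real_laplacian g u p.
Proof.
rewrite /real_laplacian /chart_laplacian -mulrN; congr (_ * _).
rewrite -sumrN; apply: eq_bigr => a _.
pose G x := \sum_b volume_density g (chart_at A p) (chart_inv (chart_at A p) x)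
  * invmx (gmat g (chart_at A p) (chart_inv (chart_at A p) x)) a b
  * partial b (u \o chart_inv (chart_at A p)) x.
rewrite [RHS](_ : _ = partial a (fun x => - G x) (chart_coord (chart_at A p) p)); last first.
  by rewrite partialN.
congr (partial a _ _); apply/funext => x; rewrite /G -sumrN; apply: eq_bigr => b _.
by rewrite -mulrN; congr (_ * _); rewrite -[RHS](congr1 (@^~ x) (partialN _ _)).
Qed.

(** The Laplacian and the eigenvalue are real, so conjugation only flips the sign of the imaginary
    part, which [Ck_onN] and [real_laplacianN] absorb. *)
Lemma Eig_conj l (u : M -> R[i]) : Eig g l u -> Eig g l (conj_fun u).
Proof.
move=> [su lu]; split=> [c|p].
  have [sr si] := su c; split=> k.
    by rewrite (_ : (fun x => _) = (fun x => complex.Re (u (chart_inv c x))))//;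
      apply/funext => x; rewrite /conj_fun; case: (u _).
  rewrite (_ : (fun x => _) = (fun x => - complex.Im (u (chart_inv c x)))).
    by apply: Ck_onN; exact: si.
  by apply/funext => x; rewrite /conj_fun; case: (u _).
have := lu p; rewrite /laplacian.
rewrite (_ : (fun q => complex.Re (conj_fun u q)) = (fun q => complex.Re (u q))); last first.
  by apply/funext => x; rewrite /conj_fun; case: (u _).
rewrite (_ : (fun q => complex.Im (conj_fun u q)) = (fun q => - complex.Im (u q))); last first.
  by apply/funext => x; rewrite /conj_fun; case: (u _).
rewrite real_laplacianN /conj_fun; case: (u p) => a b /eqP; rewrite !eq_complex/=.
rewrite !mul0r !subr0 !addr0 => /andP[/eqP -> /eqP ->].
by apply/eqP; rewrite eq_complex /= !mul0r !subr0 !addr0 mulrN !eqxx.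
Qed.

End geometry.

(** * The Riemannian volume *)

Section volume.
Context {R : realType} {M : ptopologicalType} {n : nat}.
Context {A : @smooth_atlas R M n} {g : riemannian_metric A}.
Context {vol : {measure set (borel M) -> \bar R}}.
Hypothesis volP : is_riemannian_volume g vol.

Lemma riemannian_volume_integrand_ge0 (c : chart A) (B : set M) x :
  (0 <= ((volume_density g c (chart_inv c x)) * \1_(chart_coord c @` B) x)%:E :> \bar R)%E.
Proof. by rewrite lee_fin mulr_ge0// /volume_density sqrtr_ge0. Qed.

(** The density is continuous, hence bounded by [D x0 + 1] on a small coordinate cube, and the cube
    has finite Lebesgue volume. *)
Lemma riemannian_volume_locally_finite p :
  exists V : set M, [/\ open V, V p & (vol V < +oo)%E].
Proof.
pose c := chart_at A p; have cp : dom c p := dom_chart_at A p.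
pose x0 := chart_coord c p; pose D := volume_density g c \o chart_inv c.
have : \forall x \near x0, D x < D x0 + 1.
  by apply: (cvgr_lt _ (volume_density_continuous cp)); rewrite ltrDl.
move=> /nbhs_ballP[e /= e0 De].
(* Taking the interior of the ball makes [V] open by continuity of the chart. *)
pose V := dom c `&` chart_coord c @^-1` (ball x0 e)^°.
have oV : open V.
  rewrite openE => q [cq qe]; apply: filterI.
    by apply: open_nbhs_nbhs; split=> //; exact: dom_open.
  apply: (chart_coord_continuous cq); apply: open_nbhs_nbhs; split=> //.
  exact: open_interior.
exists V; split=> //; first by split=> //; apply: nbhsx_ballx.
rewrite (volP (c := c)); [|exact: open_borel_measurable|by move=> q []].
have D0 : 0 <= D x0 + 1 by rewrite addr_ge0// sqrtr_ge0.
apply: le_lt_trans (ltry _); apply: (integral_rV_le_ball (x := x0) e0 D0).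
  exact: riemannian_volume_integrand_ge0.
move=> x; rewrite lee_fin !indicE.
have [xV|xV] := pselect ((chart_coord c @` V) x); last first.
  by rewrite memNset// mulr0 mulr_ge0.
have xe : ball x0 e x by case: xV => q [_ /interior_subset qe] <-.
by rewrite !mem_set// !mulr1; apply/ltW/De.
Qed.

(** Some coordinate cube around [p] lies in the image of [U], and the density exceeds half of its
    positive value at [p] there. *)
Lemma riemannian_volume_open_gt0 (U : set M) p : open U -> U p -> (0 < vol U)%E.
Proof.
move=> oU Up; pose c := chart_at A p; have cp : dom c p := dom_chart_at A p.
pose x0 := chart_coord c p; pose D := volume_density g c \o chart_inv c.
have x0p : chart_inv c x0 = p by exact: chart_coordK.
have D0 : 0 < D x0 by rewrite /D /= x0p; exact: volume_density_gt0.
pose V := U `&` dom c.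
have oV : open V by apply: openI => //; exact: dom_open.
have : \forall x \near x0, D x0 / 2 < D x /\ (chart_coord c @` V) x.
  apply: filterI.
    apply: (cvgr_gt _ (volume_density_continuous cp)).
    by rewrite ltr_pdivrMr// ltr_pMr// ltr1n.
  have : \forall x \near x0, (chart_coord c @` dom c) x /\ U (chart_inv c x).
    apply: filterI; first exact: chart_near_image.
    apply: chart_inv_continuous; first by exists p.
    by rewrite x0p; apply: open_nbhs_nbhs.
  apply: filterS => x [[q cq <-]]; rewrite chart_coordK// => Uq.
  by exists q.
move=> /nbhs_ballP[e /= e0 De].
(* The coordinate formula for [vol] applies only inside a chart domain, so [U] is first shrunk to
   [V]. *)
apply: (@lt_le_trans _ _ (vol V)); last first.
  by apply: le_measure; rewrite ?inE//; [exact: open_borel_measurable..|move=> q []].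
rewrite (volP (c := c)); [|exact: open_borel_measurable|by move=> q []].
apply: (@lt_le_trans _ _ ((D x0 / 2 * (e *+ 2) ^+ n)%:E)).
  by rewrite lte_fin mulr_gt0 ?divr_gt0// exprn_gt0// pmulrn_lgt0.
apply: (integral_rV_ge_ball (x := x0) e0).
- by rewrite divr_ge0// ltW.
- exact: riemannian_volume_integrand_ge0.
- by move=> x /De[/ltW Dx Vx]; rewrite indicE mem_set// mulr1 lee_fin.
Qed.

(** Finitely many of the open sets of finite volume cover [M], and the measure is subadditive. *)
Lemma riemannian_volume_finite : compact [set: M] -> (vol setT < +oo)%E.
Proof.
rewrite compact_cover => cM.
have [V HV] := choice riemannian_volume_locally_finite.
have [||D' _ D'V] := cM M setT V.
- by move=> p _; have [] := HV p.
- by move=> p _; exists p => //; have [] := HV p.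
have mV p : measurable (V p : set (borel M)).
  by apply: open_borel_measurable; have [] := HV p.
have := @content_sub_fsum _ _ (borel M) vol _ [set` D'] setT V (finite_fset D')
  (fun p _ => mV p) measurableT D'V.
move=> /le_lt_trans; apply; rewrite fsbig_finite//=; apply: lte_sum_pinfty => p _.
by have [] := HV p.
Qed.

Hypothesis M_compact : compact [set: M].

(** A bounded measurable function on a space of finite measure. This provides the integrability
    behind the algebra of [L2_inner]. *)
Lemma continuous_integrable (u : M -> R) : continuous u ->
  vol.-integrable setT (EFin \o u : borel M -> \bar R).
Proof.
move=> cu; apply: measurable_bounded_integrable => //.
- exact: riemannian_volume_finite.
- exact: continuous_borel_measurable.
- exact: continuous_bounded_on_compact.
Qed.

(** The set where [u] is nonzero is open and contained in a null set, whereas nonempty open sets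
    have positive volume. *)
Lemma continuous_Rintegral0 (u : M -> R) : continuous u -> (forall p, 0 <= u p) ->
  Rintegral vol setT (u : borel M -> R) = 0 -> forall p, u p = 0.
Proof.
move=> cu u0 iu p; apply/eqP/negPn/negP => up.
have mu := continuous_borel_measurable cu.
have iu0 : (\int[vol]_(x in setT) `|(u x)%:E| = 0)%E.
  under eq_integral do rewrite gee0_abs ?lee_fin//.
  (* [Rintegral] takes [fine] of the extended integral; finiteness is what lets its vanishing be
     lifted back. *)
  rewrite -(fineK (x := (\int[vol]_x _)%E)); first by rewrite -[fine _]/(Rintegral _ _ _) iu.
  exact: integrable_fin_num (continuous_integrable cu).
have mEu : measurable_fun setT (EFin \o u : borel M -> \bar R).
  exact/measurable_EFinP.
have [N [mN N0 uN]] := (ae_eq_integral_abs vol measurableT mEu).1 iu0.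
have oU : open (u @^-1` [set x : R | x != 0]).
  by move/continuousP : cu; apply; exact: open_neq.
have := riemannian_volume_open_gt0 oU up.
apply/negP; rewrite -leNgt -N0; apply: le_measure; rewrite ?inE//.
  exact: open_borel_measurable.
move=> q /= uq; apply: uN => /= /(_ I) [] /eqP; exact/negP.
Qed.

End volume.

(** * Conjugation and spectral projections *)

Section conj_fun.
Context {R : realType} {M : ptopologicalType}.
Implicit Types f h : M -> R[i].

Lemma conj_funK : involutive (@conj_fun R M).
Proof. by move=> f; apply/funext => p; rewrite /conj_fun; case: (f p) => a b /=; rewrite opprK. Qed.

Lemma conj_fun0 : conj_fun 0 = 0 :> (M -> R[i]).
Proof. by apply/funext => p; apply/eqP; rewrite eq_complex /= oppr0 !eqxx. Qed.

Lemma conj_funD f h : conj_fun (f + h) = conj_fun f + conj_fun h.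
Proof.
apply/funext => p; rewrite /conj_fun /GRing.add /=.
by case: (f p) (h p) => a b [c d] /=; rewrite opprD.
Qed.

Lemma conj_funB f h : conj_fun (f \- h) = conj_fun f \- conj_fun h.
Proof.
apply/funext => p; rewrite /conj_fun /=.
by case: (f p) (h p) => a b [c d] /=; rewrite opprD.
Qed.

Lemma conj_funM f h : conj_fun (f \* h) = conj_fun f \* conj_fun h.
Proof. by apply/funext => p; rewrite /conj_fun /= rmorphM. Qed.

Lemma conj_fun_sum I (r : seq I) (F : I -> M -> R[i]) :
  conj_fun (\sum_(i <- r) F i) = \sum_(i <- r) conj_fun (F i).
Proof. exact: (big_morph (@conj_fun R M) conj_funD conj_fun0). Qed.

(** Such a sum is indexed by the support of [F] in [D], and conjugation leaves the support
    unchanged. *)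
Lemma conj_fun_fsum (I : choiceType) (D : set I) (F : I -> M -> R[i]) :
  conj_fun (\sum_(i \in D) F i) = \sum_(i \in D) conj_fun (F i).
Proof.
rewrite conj_fun_sum; congr (\sum_(i <- _) _).
rewrite /finite_support !unlock; congr (finmap.enum_fset (fset_set (_ `&` _))).
apply/seteqP; split=> i /= Fi0 cFi0; apply: Fi0; last by rewrite cFi0 conj_fun0.
by rewrite -[F i]conj_funK cFi0 conj_fun0.
Qed.

(** Stated on real and imaginary parts because [smooth], [L2] and [L2_inner] are. *)
Definition complex_continuous f :=
  continuous (fun p => complex.Re (f p)) /\ continuous (fun p => complex.Im (f p)).

Lemma complex_continuous_cst (z : R[i]) : complex_continuous (fun=> z).
Proof. by split=> p; exact: cvg_cst. Qed.

Lemma complex_continuousD f h :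
  complex_continuous f -> complex_continuous h -> complex_continuous (f + h).
Proof.
move=> [fr fi] [hr hi]; split=> p.
- rewrite [X in continuous_at _ X](_ : _ = (fun q => complex.Re (f q) + complex.Re (h q))).
    by apply: cvgD; [exact: fr|exact: hr].
  by apply/funext => q; rewrite /GRing.add /=; case: (f q) (h q) => ? ? [].
- rewrite [X in continuous_at _ X](_ : _ = (fun q => complex.Im (f q) + complex.Im (h q))).
    by apply: cvgD; [exact: fi|exact: hi].
  by apply/funext => q; rewrite /GRing.add /=; case: (f q) (h q) => ? ? [].
Qed.

Lemma complex_continuousM f h :
  complex_continuous f -> complex_continuous h -> complex_continuous (f \* h).
Proof.
move=> [fr fi] [hr hi]; split=> p.
- rewrite [X in continuous_at _ X](_ : _ = (fun q =>
    complex.Re (f q) * complex.Re (h q) - complex.Im (f q) * complex.Im (h q))).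
    by apply: cvgB; apply: cvgM; [exact: fr|exact: hr|exact: fi|exact: hi].
  by apply/funext => q /=; case: (f q) (h q) => ? ? [].
- rewrite [X in continuous_at _ X](_ : _ = (fun q =>
    complex.Re (f q) * complex.Im (h q) + complex.Im (f q) * complex.Re (h q))).
    by apply: cvgD; apply: cvgM; [exact: fr|exact: hi|exact: fi|exact: hr].
  by apply/funext => q /=; case: (f q) (h q) => ? ? [].
Qed.

Lemma complex_continuousB f h :
  complex_continuous f -> complex_continuous h -> complex_continuous (f \- h).
Proof.
move=> cf ch; rewrite (_ : f \- h = f + (fun=> -1) \* h).
  apply: complex_continuousD => //; apply: complex_continuousM => //.
  exact: complex_continuous_cst.
by apply/funext => p; rewrite /GRing.add /= mulN1r.
Qed.

Lemma complex_continuous_conj f : complex_continuous f -> complex_continuous (conj_fun f).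
Proof.
move=> [fr fi]; split=> p.
- rewrite [X in continuous_at _ X](_ : _ = (fun q => complex.Re (f q))); first exact: fr.
  by apply/funext => q; rewrite /conj_fun; case: (f q).
- rewrite [X in continuous_at _ X](_ : _ = (fun q => - complex.Im (f q))).
    by apply: cvgN; exact: fi.
  by apply/funext => q; rewrite /conj_fun; case: (f q).
Qed.

Lemma complex_continuous_sum (I : eqType) (r : seq I) (F : I -> M -> R[i]) :
  (forall i, i \in r -> complex_continuous (F i)) ->
  complex_continuous (\sum_(i <- r) F i).
Proof.
move=> cF; rewrite big_seq; apply: big_ind => //.
- exact: complex_continuous_cst.
- exact: complex_continuousD.
Qed.

End conj_fun.

(** * Uniqueness of spectral projections and their commutation with conjugation *)

Section projection.
Context {R : realType} {M : ptopologicalType} {n : nat}.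
Context {A : @smooth_atlas R M n} {g : riemannian_metric A}.
Context {vol : {measure set (borel M) -> \bar R}}.
Hypothesis volP : is_riemannian_volume g vol.
Hypothesis M_compact : compact [set: M].
Implicit Types f h u v : M -> R[i].

Lemma Eig_continuous l u : Eig g l u -> complex_continuous u.
Proof.
by move=> [su _]; split; apply: (continuous_from_chart (A := A)) => c;
  have [sr si] := su c; [exact: sr 0%N|exact: si 0%N].
Qed.

Lemma Efin_continuous f : Efin g f -> complex_continuous f.
Proof.
move=> [s [u [us ->]]]; apply: complex_continuous_sum => l ls.
by apply: (Eig_continuous (l := l)); have [] := us _ ls.
Qed.

Lemma integrable_mul_conj f h : complex_continuous f -> complex_continuous h ->
  vol.-integrable setT (fun p : borel M => (complex.Re (f p * (h p)^*))%:E) /\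
  vol.-integrable setT (fun p : borel M => (complex.Im (f p * (h p)^*))%:E).
Proof.
move=> cf ch; have [cr ci] := complex_continuousM cf (complex_continuous_conj ch).
by split; apply: (continuous_integrable volP M_compact).
Qed.

Lemma L2_innerBl f h v :
  complex_continuous f -> complex_continuous h -> complex_continuous v ->
  L2_inner vol (f \- h) v = L2_inner vol f v - L2_inner vol h v.
Proof.
move=> cf ch cv.
have [fr fi] := integrable_mul_conj cf cv; have [hr hi] := integrable_mul_conj ch cv.
apply/eqP; rewrite eq_complex /=; apply/andP; split; apply/eqP.
- rewrite -RintegralB//; apply: eq_Rintegral => p _ /=.
  by case: (f p) (h p) (v p) => ? ? [? ?] [? ?] /=; ring.
- rewrite -RintegralB//; apply: eq_Rintegral => p _ /=.
  by case: (f p) (h p) (v p) => ? ? [? ?] [? ?] /=; ring.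
Qed.

Lemma L2_inner_conj f v : complex_continuous f -> complex_continuous v ->
  L2_inner vol (conj_fun f) (conj_fun v) = (L2_inner vol f v)^*.
Proof.
move=> cf cv; have [fr fi] := integrable_mul_conj cf cv.
apply/eqP; rewrite eq_complex /=; apply/andP; split; apply/eqP.
- apply: eq_Rintegral => p _ /=; rewrite /conj_fun.
  by case: (f p) (v p) => ? ? [? ?] /=; ring.
- rewrite -mulN1r -RintegralZl//; apply: eq_Rintegral => p _ /=; rewrite /conj_fun.
  by case: (f p) (v p) => ? ? [? ?] /=; ring.
Qed.

Lemma L2_innerBr f h v :
  complex_continuous f -> complex_continuous h -> complex_continuous v ->
  L2_inner vol v (f \- h) = L2_inner vol v f - L2_inner vol v h.
Proof.
move=> cf ch cv.
have [fr fi] := integrable_mul_conj cv cf; have [hr hi] := integrable_mul_conj cv ch.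
apply/eqP; rewrite eq_complex /=; apply/andP; split; apply/eqP.
- rewrite -RintegralB//; apply: eq_Rintegral => p _ /=.
  by case: (f p) (h p) (v p) => ? ? [? ?] [? ?] /=; ring.
- rewrite -RintegralB//; apply: eq_Rintegral => p _ /=.
  by case: (f p) (h p) (v p) => ? ? [? ?] [? ?] /=; ring.
Qed.

Lemma L2_inner_self_eq0 f : complex_continuous f -> L2_inner vol f f = 0 -> f = 0.
Proof.
move=> cf /(congr1 (@complex.Re _)) /= ff0.
have [cr _] := complex_continuousM cf (complex_continuous_conj cf).
have E p : complex.Re (f p * (f p)^*) = complex.Re (f p) ^+ 2 + complex.Im (f p) ^+ 2.
  by case: (f p) => ? ? /=; ring.
apply/funext => p; have := continuous_Rintegral0 volP M_compact cr _ ff0 p.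
rewrite /conj_fun E => /(_ _)/eqP; rewrite paddr_eq0 ?sqr_ge0// !sqrf_eq0.
case: (f p) => a b /= H; apply/eqP; rewrite eq_complex /=; apply: H => q.
by rewrite E addr_ge0// sqr_ge0.
Qed.

(** The predicate from which [spectral_proj] chooses by [xget]. *)
Definition is_spectral_proj l h u :=
  Eig g l u /\ forall v, Eig g l v -> L2_inner vol (h \- u) v = 0.

Lemma is_spectral_proj_unique l h u1 u2 : complex_continuous h ->
  is_spectral_proj l h u1 -> is_spectral_proj l h u2 -> u1 = u2.
Proof.
move=> ch [e1 p1] [e2 p2].
have c1 := Eig_continuous e1; have c2 := Eig_continuous e2.
have ch1 := complex_continuousB ch c1; have ch2 := complex_continuousB ch c2.
have c21 := complex_continuousB c2 c1.
suff d0 : u2 \- u1 = 0.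
  by apply/funext => p; have /eqP := congr1 (@^~ p) d0; rewrite subr_eq0 => /eqP.
apply: L2_inner_self_eq0 => //.
(* The difference of the candidates is a difference of residuals, each orthogonal to both [u1] and
   [u2]. *)
rewrite [X in L2_inner vol X _](_ : _ = (h \- u1) \- (h \- u2)); last first.
  by apply/funext => p /=; ring.
by rewrite L2_innerBl// !L2_innerBr// !p1// !p2// !subr0.
Qed.

(** Testing the conjugate residual against [v] amounts to testing the original one against the
    conjugate of [v], which lies in the same eigenspace. *)
Lemma is_spectral_proj_conj l h u : complex_continuous h ->
  is_spectral_proj l h u -> is_spectral_proj l (conj_fun h) (conj_fun u).
Proof.
move=> ch [eu pu]; split; first exact: Eig_conj.
move=> v ev; have ev' := Eig_conj ev; rewrite -conj_funB -[v]conj_funK L2_inner_conj.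
- by rewrite pu// conjc0.
- exact: complex_continuousB (Eig_continuous eu).
- exact: Eig_continuous ev'.
Qed.

Lemma spectral_proj_conj l h : complex_continuous h ->
  spectral_proj g vol l (conj_fun h) = conj_fun (spectral_proj g vol l h).
Proof.
move=> ch; rewrite /spectral_proj -/(is_spectral_proj l h) -/(is_spectral_proj l (conj_fun h)).
have [[u pu]|nu] := pselect (exists u, is_spectral_proj l h u).
  apply: is_spectral_proj_unique (complex_continuous_conj ch) _ _.
    by apply: xgetPex; exists (conj_fun u); exact: is_spectral_proj_conj.
  by apply: is_spectral_proj_conj => //; apply: xgetPex; exists u.
(* A candidate for either of [h] and its conjugate yields one for the other; when there is none,
   both choices are the default 0, which is its own conjugate. *)
rewrite [in RHS]xgetPN ?xgetPN ?conj_fun0// => u pu; apply: nu; last by exists u.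
exists (conj_fun u); rewrite -[h]conj_funK; apply: is_spectral_proj_conj => //.
exact: complex_continuous_conj.
Qed.

Lemma spectral_proj_continuous l h : complex_continuous (spectral_proj g vol l h).
Proof.
rewrite /spectral_proj; case: xgetP => [u _ [eu _]|_]; first exact: Eig_continuous eu.
exact: complex_continuous_cst.
Qed.

Lemma star_component_continuous w f h k : complex_continuous (star_component g vol w f h k).
Proof.
apply: complex_continuous_sum => lm _; apply: complex_continuousM.
  exact: complex_continuous_cst.
exact: spectral_proj_continuous.
Qed.

Lemma star_component_conj w f h k : star_compatible g w -> Spec g k ->
  complex_continuous f -> complex_continuous h ->
  star_component g vol w (conj_fun h) (conj_fun f) k =
  conj_fun (star_component g vol w f h k).
Proof.
move=> wS Sk cf ch; rewrite /star_component conj_fun_fsum.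
(* Exchanging the two indices matches the reversed factors; [star_compatible] then turns the
   exchanged coefficient into the conjugate one. *)
pose swap (lm : R * R) := (lm.2, lm.1).
rewrite (@reindex_fsbig _ _ _ _ _ swap (Spec g `*` Spec g)); last first.
  split.
  - by move=> lm [].
  - by move=> [a b] [c d] _ _ [-> ->].
  - by move=> [a b] [Sa Sb]; exists (b, a).
apply: eq_fsbigr => -[l m] /set_mem[/= Sl Sm]; apply/funext => p.
rewrite wS// !spectral_proj_conj// -conj_funM spectral_proj_conj; last first.
  by apply: complex_continuousM; exact: spectral_proj_continuous.
rewrite /conj_fun rmorphM; congr (_ * (spectral_proj _ _ _ _ _)^*).
by apply/funext => q /=; rewrite mulrC.
Qed.

End projection.

(** * Sums in L2 *)

Section L2_sum.
Context {R : realType} {M : ptopologicalType}.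
Context {vol : {measure set (borel M) -> \bar R}}.
Implicit Types f h s : M -> R[i].

Definition complex_measurable f :=
  measurable_fun setT (fun p : borel M => complex.Re (f p)) /\
  measurable_fun setT (fun p : borel M => complex.Im (f p)).

Lemma complex_continuous_measurable f : complex_continuous f -> complex_measurable f.
Proof. by move=> [fr fi]; split; exact: continuous_borel_measurable. Qed.

Lemma complex_measurableB f h :
  complex_measurable f -> complex_measurable h -> complex_measurable (f \- h).
Proof.
move=> [fr fi] [hr hi]; split.
- rewrite [X in measurable_fun _ X](_ : _ = (fun q => complex.Re (f q) - complex.Re (h q))).
    exact: measurable_funB.
  by apply/funext => q /=; case: (f q) (h q) => ? ? [].
- rewrite [X in measurable_fun _ X](_ : _ = (fun q => complex.Im (f q) - complex.Im (h q))).
    exact: measurable_funB.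
  by apply/funext => q /=; case: (f q) (h q) => ? ? [].
Qed.

Definition normsq (z : R[i]) : R := complex.Re z ^+ 2 + complex.Im z ^+ 2.

Lemma normsq_ge0 z : 0 <= normsq z.
Proof. by rewrite addr_ge0// sqr_ge0. Qed.

Lemma measurable_normsq f : complex_measurable f ->
  measurable_fun setT (fun p : borel M => (normsq (f p))%:E).
Proof.
move=> [fr fi]; apply/measurable_EFinP; rewrite /normsq.
by apply: measurable_funD; exact: measurable_funX.
Qed.

(** A triangle inequality for squared norms, obtained by integrating a pointwise bound; the factor 2
    avoids square roots. *)
Lemma L2_norm_sq_triangle f h s :
  complex_measurable f -> complex_measurable h -> complex_measurable s ->
  (L2_norm_sq vol (f \- h)%R <=
   2%:E * (L2_norm_sq vol (f \- s)%R + L2_norm_sq vol (h \- s)%R))%E.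
Proof.
move=> mf mh ms.
have mfs := measurable_normsq (complex_measurableB mf ms).
have mhs := measurable_normsq (complex_measurableB mh ms).
have mfh := measurable_normsq (complex_measurableB mf mh).
rewrite /L2_norm_sq -ge0_integralD//; last 2 first.
- by move=> p _; rewrite lee_fin normsq_ge0.
- by move=> p _; rewrite lee_fin normsq_ge0.
rewrite -ge0_integralZl//; last 2 first.
- exact: (emeasurable_funD mfs mhs).
- by move=> p _; rewrite adde_ge0// lee_fin normsq_ge0.
apply: ge0_le_integral => //.
- by move=> p _; rewrite lee_fin normsq_ge0.
- by apply: measurable_funeM; exact: (emeasurable_funD mfs mhs).
move=> p _ /=; rewrite -EFinD -EFinM lee_fin.
case: (f p) (h p) (s p) => a a' [b b'] [c c'] /=.
(* Parallelogram identity: the gap between the two sides is the squared modulus of [f + h - 2 s] at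
   [p]. *)
rewrite -subr_ge0; have -> : 2 * ((a - c) ^+ 2 + (a' - c') ^+ 2 +
    ((b - c) ^+ 2 + (b' - c') ^+ 2)) - ((a - b) ^+ 2 + (a' - b') ^+ 2)
  = (a + b - 2 * c) ^+ 2 + (a' + b' - 2 * c') ^+ 2 by ring.
by rewrite addr_ge0// sqr_ge0.
Qed.

Lemma L2_norm_sq_le0 f h : complex_measurable f -> complex_measurable h ->
  (L2_norm_sq vol (f \- h)%R <= 0)%E -> L2_eq vol f h.
Proof.
move=> mf mh fh0; have mfh := measurable_normsq (complex_measurableB mf mh).
have : (\int[vol]_p `|(normsq ((f \- h)%R p))%:E| = 0)%E.
  under eq_integral do rewrite gee0_abs ?lee_fin ?normsq_ge0//.
  by apply/eqP; rewrite eq_le fh0 integral_ge0// => p _; rewrite lee_fin normsq_ge0.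
move=> /(ae_eq_integral_abs vol measurableT mfh).1.
apply: filterS => p /(_ I) [] /eqP; rewrite paddr_eq0 ?sqr_ge0// !sqrf_eq0.
rewrite /=; case: (f p) (h p) => a a' [b b'] /=.
by rewrite !subr_eq0 => /andP[/eqP -> /eqP ->].
Qed.

Lemma L2_sum_unique (J : set R) (F : R -> M -> R[i]) f h :
  (forall k, complex_measurable (\sum_(x \in k) F x)) ->
  L2_sum vol J F f -> L2_sum vol J F h -> L2_eq vol f h.
Proof.
move=> mF [[fr fi _] cf] [[hr hi _] ch]; apply: L2_norm_sq_le0 => //.
apply/lee_addgt0Pr => e e0; rewrite add0e.
(* The finite sum over the union of both index sets is within [e / 4] of each limit in squared norm,
   and [2 * (e / 4 + e / 4) = e]. *)
have e4 : 0 < e / 4 by rewrite divr_gt0.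
have [Af [finf AfJ Hf]] := cf _ e4; have [Ah [finh AhJ Hh]] := ch _ e4.
apply: le_trans (L2_norm_sq_triangle _ _ (mF (Af `|` Ah))) _ => //.
apply: (@le_trans _ _ (2%:E * ((e / 4)%:E + (e / 4)%:E))%E).
  apply: lee_wpmul2l; first by rewrite lee_fin.
  have finU : finite_set (Af `|` Ah) by rewrite finite_setU.
  have UJ : Af `|` Ah `<=` J by rewrite subUset.
  by apply: leeD; [exact: Hf (@subsetUl _ _ _) UJ|exact: Hh (@subsetUr _ _ _) UJ].
by rewrite -EFinD -EFinM lee_fin; lra.
Qed.

Lemma L2_norm_sq_conj f : L2_norm_sq vol (conj_fun f) = L2_norm_sq vol f.
Proof.
apply: eq_integral => p _; rewrite /conj_fun; case: (f p) => a b /=.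
by rewrite sqrrN.
Qed.

Lemma L2_conj f : L2 vol f -> L2 vol (conj_fun f).
Proof.
move=> [fr fi f2]; split; last by rewrite L2_norm_sq_conj.
- by rewrite (_ : (fun p => _) = (fun p => complex.Re (f p)))//;
    apply/funext => p; rewrite /conj_fun; case: (f p).
- rewrite (_ : (fun p => _) = (fun p => - complex.Im (f p))).
    exact: measurable_funN.
  by apply/funext => p; rewrite /conj_fun; case: (f p).
Qed.

(** Conjugation preserves [L2_norm_sq] and commutes with finite sums, so the same finite set [A0]
    serves. *)
Lemma L2_sum_conj (J : set R) (F G : R -> M -> R[i]) f :
  (forall k, J k -> G k = conj_fun (F k)) ->
  L2_sum vol J F f -> L2_sum vol J G (conj_fun f).
Proof.
move=> GF [f2 cf]; split; first exact: L2_conj.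
move=> e e0; have [A0 [finA0 A0J HA0]] := cf _ e0; exists A0; split=> // B finB A0B BJ.
rewrite (eq_fsbigr (fun k => conj_fun (F k))); last by move=> k /set_mem /BJ /GF.
by rewrite -conj_fun_fsum -conj_funB L2_norm_sq_conj; exact: HA0.
Qed.

End L2_sum.

Theorem proposition5p3 (R : realType) (M : ptopologicalType) (n : nat)
  (A : @smooth_atlas R M n) (g : riemannian_metric A)
  (vol : {measure set (borel M) -> \bar R})
  (M_hausdorff : hausdorff_space M)
  (M_compact : compact [set: M])
  (volP : is_riemannian_volume g vol)
  (w : R -> R -> R -> R[i])
  (w_unit : twisting_system g w)
  (w_star : star_compatible g w)
  (f h : M -> R[i]) (hf : Efin g f) (hh : Efin g h) :
  L2_eq vol (conj_fun (star g vol w f h))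
            (star g vol w (conj_fun h) (conj_fun f)).
Proof.
have cf := Efin_continuous hf; have ch := Efin_continuous hh.
set F := star_component g vol w f h.
set G := star_component g vol w (conj_fun h) (conj_fun f).
have GF k : Spec g k -> G k = conj_fun (F k).
  by move=> Sk; exact: (star_component_conj volP M_compact w_star Sk).
have FG k : Spec g k -> F k = conj_fun (G k) by move=> /GF ->; rewrite conj_funK.
(* If [F] is summable, both stars are genuine sums; the conjugate of the first is a sum of [G], and
   two sums of [G] agree almost everywhere. *)
have [[s Fs]|nF] := pselect (exists s, L2_sum vol (Spec g) F s).
  apply: (@L2_sum_unique _ _ vol (Spec g) G).
  - move=> k; apply: complex_continuous_measurable; apply: complex_continuous_sum.
    by move=> l _; exact: star_component_continuous.
  - by apply: (L2_sum_conj GF); apply: (@xgetPex _ _ (L2_sum vol (Spec g) F)); exists s.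
  - apply: (@xgetPex _ _ (L2_sum vol (Spec g) G)).
    by exists (conj_fun s); exact: L2_sum_conj Fs.
(* Otherwise [G] has no sum either, and both stars are the default 0. *)
have nG : ~ exists s, L2_sum vol (Spec g) G s.
  by move=> [s Gs]; apply: nF; exists (conj_fun s); exact: L2_sum_conj Gs.
have -> : star g vol w f h = 0.
  by apply: (@xgetPN _ _ (L2_sum vol (Spec g) F)) => s Fs; apply: nF; exists s.
have -> : star g vol w (conj_fun h) (conj_fun f) = 0.
  by apply: (@xgetPN _ _ (L2_sum vol (Spec g) G)) => s Gs; apply: nG; exists s.
by rewrite conj_fun0; apply: aeW.
Qed.
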